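(* Let assumptions A1, A2, A3 (stated in the context) hold, let the data be exact ($\delta_0 = \dots = \delta_{N-1} = 0$), and let $(x_k)$ be generated by the PLWK iteration described in the context. If $\inf_k \theta_k > 0$ and $\sup_k \theta_k < 2$, then $(x_k)$ converges weakly to some $\bar x \in B_\rho(x_0)$ satisfying $F_i(\bar x) = y_i$ for $i = 0,\dots,N-1$.
   Context: $X$ and $Y$ are real Hilbert spaces, $N \ge 1$ is an integer, $F_i : D(F_i) \subset X \to Y$, $i = 0,\dots,N-1$, are (in general nonlinear) operators, and $y_0,\dots,y_{N-1} \in Y$ are exact data. $B_r(x)$ denotes the open ball of radius $r$ centred at $x$ in $X$. Assumption A1: each $F_i$ is continuous on $D(F_i)$; $D := \bigcap_{i} D(F_i)$ has nonempty interior; the initial iterate $x_0 \in D$ is given and there exist constants $C, \rho > 0$ such that $B_\rho(x_0) \subset D$, the Gateaux derivative $F_i'$ is defined on $B_\rho(x_0)$ (with each $F_i'(x): X \to Y$ bounded linear), and $\|F_i'(x)\| \le C$ for all $x \in B_\rho(x_0)$ and $i = 0,\dots,N-1$. Assumption A2 (tangential cone condition): there is a constant $0 \le \eta < 1$ such that $\|F_i(\bar x) - F_i(x) - F_i'(x)(\bar x - x)\| \le \eta\, \|F_i(\bar x) - F_i(x)\|$ for all $x, \bar x \in B_\rho(x_0)$ and $i = 0,\dots,N-1$. Assumption A3: there exists $x^\star \in B_{\rho/2}(x_0)$ with $F_i(x^\star) = y_i$ for $i = 0,\dots,N-1$. PLWK iteration for exact data: write $[k] := k \bmod N \in \{0,\dots,N-1\}$.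 Starting from $x_0$, $$x_{k+1} := x_k - \theta_k \lambda_k \omega_k F_{[k]}'(x_k)^*\big(F_{[k]}(x_k) - y_{[k]}\big),$$ where $\theta_k \in (0,2)$ is a relaxation parameter, $\omega_k := 1$ if $F_{[k]}(x_k) \ne y_{[k]}$ and $\omega_k := 0$ otherwise, and $$\lambda_k := \frac{(1-\eta)\,\|F_{[k]}(x_k) - y_{[k]}\|^2}{\big\|F_{[k]}'(x_k)^*\big(F_{[k]}(x_k) - y_{[k]}\big)\big\|^2}$$ if $F_{[k]}'(x_k)^*(F_{[k]}(x_k) - y_{[k]}) \ne 0$, and $\lambda_k := 0$ otherwise. (Here $F_i'(x)^*$ is the Hilbert space adjoint. Under A1–A3 all iterates stay in $B_\rho(x_0)$, so the sequence is well defined.) *)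

(* Defs.v *)
From HB Require Import structures.
From mathcomp Require Import all_boot all_order all_algebra.
From mathcomp Require Import sesquilinear.
From mathcomp Require Import all_classical all_reals all_analysis.

Set Implicit Arguments.
Unset Strict Implicit.
Unset Printing Implicit Defensive.

Import Order.TTheory GRing.Theory Num.Theory.
Import numFieldNormedType.Exports.

Local Open Scope classical_set_scope.
Local Open Scope ring_scope.

(* A real Hilbert space is a complete normed space whose norm is induced by an
   inner product, i.e. by a symmetric positive definite bilinear form (the
   involution of the sesquilinear library is the identity over the reals). *)
HB.mixin Record CompleteNormedModule_isHilbert (R : realType) X
    & CompleteNormedModule R X := {
  inner : {dot X for (@idfun R)} ;
  inner_norm : forall u : X, inner u u = `|u| ^+ 2
}.

#[short(type="hilbertType")]
HB.structure Definition Hilbert (R : realType) :=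
  {X of CompleteNormedModule R X & CompleteNormedModule_isHilbert R X}.

Section Operators.
Context {R : realType}.

(* Extended-real valued, so that the norm of an unbounded operator is +oo
   and [opnorm A <= C%:E] is meaningful for every map A. *)
Definition opnorm (V W : normedModType R) (A : V -> W) : \bar R :=
  ereal_sup [set `|A v|%:E | v in [set v : V | `|v| <= 1]].

Definition bounded_linear (V W : normedModType R) (A : V -> W) : Prop :=
  linear A /\ (opnorm A < +oo)%E.

Definition weakly_cvg (V : normedModType R) (u : nat -> V) (l : V) : Prop :=
  forall f : V -> R^o, bounded_linear f -> f (u k) @[k --> \oo] --> f l.

Definition gateaux (V W : normedModType R) (f : V -> W) (x : V) : V -> W :=
  fun v => 'D_v f x.

Definition gateaux_differentiable (V W : normedModType R) (f : V -> W)
    (x : V) : Prop :=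
  (forall v, derivable f x v) /\ bounded_linear (gateaux f x).

(* The vector adjoint A w is characterized by (A v | w) = (v | adjoint A w)
   for all v; for bounded linear A it exists by the Riesz theorem, and it is
   always unique. *)
Definition adjoint (X Y : hilbertType R) (A : X -> Y) (w : Y) : X :=
  xget 0 [set z : X | forall v : X, inner (A v) w = inner v z].

End Operators.

(* A partial operator F_i : D(F_i) -> Y is represented by a total function
   F i together with its domain D i.  Values outside of D i play no role: the
   derivatives are only taken on an open ball contained in every D i. *)
Section PLWK.
Context {R : realType} {X Y : hilbertType R} {N : nat}.
Variables (D : 'I_N -> set X) (F : 'I_N -> X -> Y) (y : 'I_N -> Y).

Definition assumption_A1 (x0 : X) (C rho : R) : Prop :=
  [/\ forall i, {within D i, continuous (F i)},
      (\bigcap_i D i)° !=set0,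
      (\bigcap_i D i) x0,
      0 < C /\ 0 < rho &
      [/\ ball x0 rho `<=` \bigcap_i D i,
          forall i x, ball x0 rho x -> gateaux_differentiable (F i) x &
          forall i x, ball x0 rho x -> (opnorm (gateaux (F i) x) <= C%:E)%E]].

Definition assumption_A2 (x0 : X) (rho eta : R) : Prop :=
  0 <= eta < 1 /\
  forall i x x', ball x0 rho x -> ball x0 rho x' ->
    `|F i x' - F i x - gateaux (F i) x (x' - x)| <= eta * `|F i x' - F i x|.

Definition assumption_A3 (x0 : X) (rho : R) : Prop :=
  exists xs : X, ball x0 (rho / 2) xs /\ forall i, F i xs = y i.

Definition cyc (N_gt0 : (0 < N)%N) (k : nat) : 'I_N :=
  Ordinal (ltn_pmod k N_gt0).

Definition plwk_dir (i : 'I_N) (x : X) : X :=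
  adjoint (gateaux (F i) x) (F i x - y i).

Definition plwk_omega (i : 'I_N) (x : X) : R :=
  if F i x != y i then 1 else 0.

Definition plwk_lambda (eta : R) (i : 'I_N) (x : X) : R :=
  if plwk_dir i x != 0 then
    (1 - eta) * `|F i x - y i| ^+ 2 / `|plwk_dir i x| ^+ 2
  else 0.

Definition plwk_sequence (N_gt0 : (0 < N)%N) (eta : R) (theta : nat -> R)
    (x0 : X) (x : nat -> X) : Prop :=
  x 0%N = x0 /\
  forall k, let i := cyc N_gt0 k in
    x k.+1 = x k - (theta k * plwk_lambda eta i (x k) * plwk_omega i (x k))
                     *: plwk_dir i (x k).

End PLWK.

(* Main.v *)
Require Import Defs.
From HB Require Import structures.
From mathcomp Require Import all_boot all_order all_algebra.
From mathcomp Require Import sesquilinear zify ring lra.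
From mathcomp Require Import all_classical all_reals all_analysis.
Import Order.TTheory GRing.Theory Num.Theory.
Import numFieldNormedType.Exports.
Local Open Scope classical_set_scope.
Local Open Scope ring_scope.

(** By the tangential cone condition, every solution [z] in the ball lies in the
    half-space of points [p] with [(x k - p | d) >= (1 - eta) |r|^2], where [r] is
    the current residual and [d] the adjoint derivative applied to [r]
    ([tangential_cone_descent]).  One iteration is the projection of [x k] onto
    that half-space, relaxed by [theta k], so it decreases the squared distance to
    every solution by at least [theta k * (2 - theta k)] times a gain that
    dominates, up to constants, the squared step and the squared residual
    ([plwk_step]).

    Hence the iterates stay in the ball, their distances to each solution are
    nonincreasing, and, because the relaxation parameters keep away from 0 and 2,
    the gains tend to 0; so do the steps and the residuals of the equations as
    they are treated in turn.

    Weak limits are handled by the cone condition linearized at a weak cluster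
    point: it shows that the point solves every equation whose residual vanishes
    along the approximating family
    ([tangential_cone_weak_closed]).  For a fixed equation this family is the
    iterates at the times when it is treated, at most two sweeps away; these have
    the same weak limit because the steps tend to 0.

    Thus all weak cluster points are solutions, and Fejer monotonicity makes them
    coincide ([opial]).  Weak cluster points are taken along ultrafilters, and
    their existence ([weak_compactness]), like that of adjoints, rests on the
    Riesz representation theorem ([riesz]). *)

Set Implicit Arguments.
Unset Strict Implicit.

(** * Inner product identities *)

Lemma innerC (R : realType) (X : hilbertType R) (u v : X) :
  inner u v = inner v u.
Proof. by rewrite hermC expr0 mul1r. Qed.

Lemma innerZl (R : realType) (X : hilbertType R) (a : R) (u v : X) :
  inner (a *: u) v = a * inner u v.
Proof. by rewrite linearZl_LR. Qed.

Lemma innerZr (R : realType) (X : hilbertType R) (a : R) (u v : X) :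
  inner u (a *: v) = a * inner u v.
Proof. by rewrite innerC innerZl innerC. Qed.

Lemma innerBl (R : realType) (X : hilbertType R) (u v w : X) :
  inner (u - v) w = inner u w - inner v w.
Proof. by rewrite linearBl. Qed.

Lemma sqnormD (R : realType) (X : hilbertType R) (u v : X) :
  `|u + v| ^+ 2 = `|u| ^+ 2 + 2 * inner u v + `|v| ^+ 2.
Proof.
by rewrite -!inner_norm linearDl !linearDr /= (innerC v u); ring.
Qed.

Lemma sqnormB (R : realType) (X : hilbertType R) (u v : X) :
  `|u - v| ^+ 2 = `|u| ^+ 2 - 2 * inner u v + `|v| ^+ 2.
Proof. by rewrite sqnormD linearNr normrN; ring. Qed.

Lemma sqnormZ (R : realType) (X : hilbertType R) (a : R) (u : X) :
  `|a *: u| ^+ 2 = a ^+ 2 * `|u| ^+ 2.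
Proof. by rewrite -!inner_norm innerZl innerZr; ring. Qed.

Lemma cauchy_schwarz (R : realType) (X : hilbertType R) (u v : X) :
  `|inner u v| <= `|u| * `|v|.
Proof.
have [->|v0] := eqVneq v 0.
  by rewrite linear0r !normr0 mulr0.
have nv : 0 < `|v| by rewrite normr_gt0.
rewrite -ler_sqr ?nnegrE ?mulr_ge0// exprMn real_normK ?num_real//.
rewrite -(ler_pM2r (exprn_gt0 2 nv)) -subr_ge0.
have : 0 <= `|(`|v| ^+ 2) *: u - inner u v *: v| ^+ 2 by exact: sqr_ge0.
rewrite sqnormB !sqnormZ innerZl innerZr.
by congr (0 <= _); ring.
Qed.

Lemma cauchy_schwarz_le (R : realType) (X : hilbertType R) (u v : X) :
  inner u v <= `|u| * `|v|.
Proof. exact: le_trans (ler_norm _) (cauchy_schwarz _ _). Qed.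

(** * Null families *)

Lemma sqnorm_le_cvg0 (R : realType) (V : normedModType R) (T : Type)
    (F : set_system T) {FF : Filter F} (u : T -> V) (g : T -> R) :
  (\near F, `|u F| ^+ 2 <= g F) -> g t @[t --> F] --> 0 ->
  u t @[t --> F] --> 0.
Proof.
move=> ug g0; apply/cvgr0Pnorm_lt => e e0.
apply: filterS2 ug (cvgr0_norm_lt _ g0 _ (exprn_gt0 2 e0)) => t ut gt.
rewrite -ltr_sqr ?nnegrE ?normr_ge0 ?(ltW e0)//; apply: le_lt_trans ut _.
exact: le_lt_trans (ler_norm _) gt.
Qed.

Lemma norm_le_cvg0 (R : realType) (V W : normedModType R) (T : Type)
    (F : set_system T) {FF : Filter F} (u : T -> V) (g : T -> W) (M : R) :
  (\near F, `|g F| <= M * `|u F|) -> u t @[t --> F] --> 0 ->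
  g t @[t --> F] --> 0.
Proof.
move=> gu u0; apply/norm_cvg0P.
apply: (@squeeze_cvgr _ _ _ _ (fun=> 0) (fun t => M * `|u t|)).
- by apply: filterS gu => t ->; rewrite normr_ge0.
- exact: cvg_cst.
- rewrite -[X in _ --> X](mulr0 M); apply: cvgM; first exact: cvg_cst.
  exact/norm_cvg0P.
Qed.

(** * Bounded linear maps and the Riesz representation *)

Lemma opnorm_le (R : realType) (V W : normedModType R) (A : V -> W) (C : R) :
  linear A -> (opnorm A <= C%:E)%E -> forall v, `|A v| <= C * `|v|.
Proof.
move=> linA AC v.
pose L := HB.pack_for {linear V -> W} A (GRing.isLinear.Build _ _ _ _ _ linA).
have AE u : A u = L u by [].
have [->|v0] := eqVneq v 0; first by rewrite AE linear0 !normr0 mulr0.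
have nv : 0 < `|v| by rewrite normr_gt0.
suff : (`|A (`|v|^-1 *: v)|%:E <= C%:E)%E.
  by rewrite lee_fin AE linearZ normrZ normfV normr_id mulrC ler_pdivrMr.
apply: le_trans AC.
apply: ereal_sup_ubound; exists (`|v|^-1 *: v) => //=.
by rewrite normrZ normfV normr_id mulVf// gt_eqF.
Qed.

Lemma bounded_linear_le (R : realType) (V W : normedModType R) (A : V -> W) :
  bounded_linear A -> exists2 M, 0 <= M & forall v, `|A v| <= M * `|v|.
Proof.
move=> [linA Afin].
have A0 : (0 <= opnorm A)%E.
  apply: le_trans (_ : `|A 0|%:E <= _)%E; first by rewrite lee_fin.
  by apply: ereal_sup_ubound; exists 0 => //=; rewrite normr0.
have fA : opnorm A \is a fin_num by rewrite ge0_fin_numE.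
exists (fine (opnorm A)); first exact: fine_ge0.
by apply: opnorm_le => //; rewrite fineK.
Qed.

(** The representing vector minimizes the strictly convex functional
    [J u = |u|^2 - 2 f u], which is bounded below because [f] is bounded.  The
    parallelogram identity makes every minimizing sequence Cauchy, and the
    first-order condition at the limit [z] reads [f v = inner v z]. *)
Lemma riesz (R : realType) (X : hilbertType R) (f : X -> R) :
  bounded_linear (f : X -> R^o) -> exists z : X, forall v, f v = inner v z.
Proof.
move=> bf; have [M M0 fM] := bounded_linear_le bf.
have {}fM v : `|f v| <= M * `|v| := fM v; case: bf => linf _.
pose L := HB.pack_for {linear X -> R^o} f (GRing.isLinear.Build _ _ _ _ _ linf).
have fD u v : f (u + v) = f u + f v by exact: (linearD L).
have fZ a v : f (a *: v) = a * f v by rewrite -[f]/(L : _ -> _) linearZ.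
have fB u v : f (u - v) = f u - f v by exact: (linearB L).
pose J u := `|u| ^+ 2 - 2 * f u.
have Jlb : has_inf (range J).
  split; first by exists (J 0), 0.
  exists (- M ^+ 2) => _ [u _ <-].
  have := fM u; rewrite ler_norml => /andP[_ ?].
  have := sqr_ge0 (`|u| - M); rewrite /J; nra.
set m := inf (range J).
have Jm u : m <= J u by apply: ge_inf; [exact: Jlb.2|exists u].
have Jex n : exists v, J v < m + n.+1%:R^-1.
  have [|_ [v _ <-] ?] := @inf_adherent _ (range J) n.+1%:R^-1 _ Jlb.
    by rewrite invr_gt0.
  by exists v.
have [u uP] := choice Jex.
(* Parallelogram identity, with [J >= m] applied at the midpoint. *)
have udist p q : `|u p - u q| ^+ 2 <= 2 * p.+1%:R^-1 + 2 * q.+1%:R^-1.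
  have := Jm (2^-1 *: (u p + u q)); move: (uP p) (uP q).
  rewrite /J sqnormZ fZ fD sqnormD sqnormB.
  by move: (p.+1%:R^-1) (q.+1%:R^-1) => a b; lra.
have cu : cauchy (u @ \oo).
  apply/cauchyP => e e0.
  have e4 : 0 < e ^+ 2 / 4 by rewrite divr_gt0// exprn_gt0.
  have [n _ nP] := near_infty_natSinv_lt (PosNum e4).
  exists (u n), n => // p np; rewrite /= -ball_normE /=.
  rewrite -ltr_sqr ?nnegrE ?normr_ge0 ?(ltW e0)//; apply: le_lt_trans (udist _ _) _.
  have hp : p.+1%:R^-1 < e ^+ 2 / 4 :> R := nP _ np.
  have hn : n.+1%:R^-1 < e ^+ 2 / 4 :> R := nP _ (leqnn n).
  by move: (p.+1%:R^-1) (n.+1%:R^-1) (e ^+ 2) hp hn => a b c; lra.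
have /cauchy_cvgP/cvg_ex[z uz] := cu.
have uz0 : u n - z @[n --> \oo] --> 0.
  by apply/subr_cvg0.
have fcont : f (u n) @[n --> \oo] --> f z.
  apply/subr_cvg0; apply: norm_le_cvg0 uz0.
  by apply: nearW => n; rewrite -fB; exact: fM.
have Jz : J z <= m.
  have Jcvg : J (u n) @[n --> \oo] --> J z.
    apply: cvgB; last by apply: cvgM => //; exact: cvg_cst.
    rewrite !expr2; under eq_fun do rewrite expr2.
    by apply: cvgM; apply: cvg_norm.
  rewrite -[m]addr0.
  apply: (ler_cvg_to Jcvg (cvgD (cvg_cst m) cvg_harmonic)).
  by apply: nearW => n; exact: ltW.
exists z => v.
have varz t : 0 <= 2 * t * (inner v z - f v) + t ^+ 2 * `|v| ^+ 2.
  have := le_trans Jz (Jm (z + t *: v)).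
  rewrite /J sqnormD sqnormZ fD fZ innerZr (innerC z v).
  lra.
(* A nonnegative quadratic polynomial in [t] without constant term has a zero
   linear coefficient.  With [c = inner v z - f v], the value
   [t = - c / (|v|^2 + 1)] shows it also when [v = 0]. *)
apply/esym/eqP; rewrite -subr_eq0 -sqrf_eq0 eq_le sqr_ge0 andbT.
have N0 : 0 < `|v| ^+ 2 + 1 by rewrite ltr_wpDl// sqr_ge0.
have := varz (- (inner v z - f v) / (`|v| ^+ 2 + 1)).
have := sqr_ge0 `|v|.
move: (inner v z - f v) (`|v| ^+ 2) N0 => c N N0 N1.
rewrite -(pmulr_rge0 _ (exprn_gt0 2 N0)).
have -> : (N + 1) ^+ 2 * (2 * (- c / (N + 1)) * c + (- c / (N + 1)) ^+ 2 * N)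
    = - (c ^+ 2 * (N + 2)) by field; rewrite gt_eqF.
rewrite oppr_ge0 pmulr_lle0//; lra.
Qed.

(** [adjoint] is a choice that defaults to 0, so its defining property has to be
    backed by existence, which is the Riesz theorem for [v |-> (A v | w)]. *)
Lemma adjointE (R : realType) (X Y : hilbertType R) (A : X -> Y) (w : Y) :
  bounded_linear A -> forall v, inner (A v) w = inner v (adjoint A w).
Proof.
move=> bA; have [M M0 AM] := bounded_linear_le bA; case: bA => linA _.
have [|z zP] := @riesz R X (fun v => inner (A v) w).
  split.
    by move=> a u v; rewrite linA linearDl /= innerZl.
  apply: (@le_lt_trans _ _ (M * `|w|)%:E); last by rewrite ltry.
  apply: ub_ereal_sup => _ [v /= v1 <-]; rewrite lee_fin.
  apply: le_trans (cauchy_schwarz _ _) _.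
  rewrite ler_wpM2r//; apply: le_trans (AM v) _.
  by rewrite ler_piMr.
move=> v; rewrite /adjoint.
by case: xgetP => [z' _ ->//|/(_ z)/(_ zP)].
Qed.

(** * Weak compactness by ultrafilters and Opial's lemma *)

Lemma fmap_ultra (T S : Type) (f : T -> S) (U : set_system T) :
  UltraFilter U -> UltraFilter (f @ U).
Proof.
move=> UU; split; first exact: fmap_proper_filter.
move=> G GF UG; rewrite eqEsubset; split=> // A GA.
have [//|UnA] := in_ultra_setVsetC (f @^-1` A) UU.
have /filterI/(_ GA) : G (~` A) by exact: UG.
by move=> /filter_ex [? []].
Qed.

Lemma ultra_cvg_bounded (R : realType) (T : Type) (U : set_system T)
    (UU : UltraFilter U) (f : T -> R) (M : R) :
  (forall t, `|f t| <= M) -> exists l : R, f t @[t --> U] --> l.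
Proof.
move=> fM.
have := @segment_compact R (- M) M; rewrite compact_ultra => /(_ (f @ U)).
case.
- exact: fmap_ultra.
- by apply: nearW => t /=; rewrite in_itv /= -ler_norml.
- by move=> l [_ fl]; exists l.
Qed.

(** Along an ultrafilter every bounded real family converges, so the limits of
    [inner (u n) v] exist for all [v] at once, with no diagonal extraction.  They
    form a functional of [v] bounded by [M], which Riesz represents. *)
Lemma weak_compactness (R : realType) (X : hilbertType R)
    (U : set_system nat) (UU : UltraFilter U) (u : nat -> X) (M : R) :
  (forall t, `|u t| <= M) ->
  exists a, forall v, inner (u t) v @[t --> U] --> inner a v.
Proof.
move=> uM.
have /choice[phi phiP] v : exists l : R, inner (u t) v @[t --> U] --> l.
  apply: (@ultra_cvg_bounded _ _ _ _ _ (M * `|v|)) => t.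
  by apply: le_trans (cauchy_schwarz _ _) _; rewrite ler_wpM2r.
have [|a aP] := @riesz R X phi; last first.
  by exists a => v; rewrite innerC -aP.
split=> [c v w|].
  apply: (@cvg_unique _ (@Rhausdorff R) _ _ _ _ (phiP (c *: v + w))).
  have -> : (fun t => inner (u t) (c *: v + w)) =
      (fun t => c * inner (u t) v + inner (u t) w).
    by apply/funext => t; rewrite linearDr /= innerZr.
  by apply: cvgD => //; apply: cvgM => //; exact: cvg_cst.
apply: (@le_lt_trans _ _ M%:E); last by rewrite ltry.
apply: ub_ereal_sup => _ [v /= v1 <-]; rewrite lee_fin.
apply: (ler_cvg_to (cvg_norm (phiP v)) (cvg_cst M)).
apply: nearW => t; apply: le_trans (cauchy_schwarz _ _) _.
apply: le_trans (_ : M * `|v| <= _); first by rewrite ler_wpM2r.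
by rewrite ler_piMr// (le_trans _ (uM t)).
Qed.

(** If some neighbourhood of [l] were missed frequently, an ultrafilter refining
    [F] would contain the set where it is missed. *)
Lemma cvg_ultra (T : Type) (S : topologicalType) (F : set_system T)
    {FF : ProperFilter F} (f : T -> S) (l : S) :
  (forall U, UltraFilter U -> F `<=` U -> f t @[t --> U] --> l) ->
  f t @[t --> F] --> l.
Proof.
move=> fU A Al; apply: contrapT => nFA.
have FW : ProperFilter (within (~` (f @^-1` A)) F).
  split; last exact: within_filter.
  rewrite /within /= => h; apply: nFA.
  by apply: filterS h => t /contrapT.
have [U [UU WU]] := ultraFilterLemma FW.
have FU : F `<=` U.
  by move=> B FB; apply: WU; rewrite /within /=; apply: filterS FB => t.
have UA : U (f @^-1` A) := fU U UU FU A Al.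
have UnA : U (~` (f @^-1` A)) by apply: WU; rewrite /within /=; apply: nearW.
have /filter_ex[t []//] : U (f @^-1` A `&` ~` (f @^-1` A)) by exact: filterI.
Qed.

(** Weak lower semicontinuity of the norm: test the weak limit against
    [a - z] itself. *)
Lemma weak_cvg_ball (R : realType) (X : hilbertType R) (U : set_system nat)
    {UU : ProperFilter U} (u : nat -> X) (a z : X) (r : R) :
  (forall v, inner (u n) v @[n --> U] --> inner a v) ->
  (forall n, `|u n - z| <= r) -> `|a - z| <= r.
Proof.
move=> ua uz; have [->|az] := eqVneq (a - z) 0.
  by rewrite normr0 (le_trans _ (uz 0%N)).
have naz : 0 < `|a - z| by rewrite normr_gt0.
rewrite -(ler_pM2r naz) -expr2 -inner_norm innerBl.
apply: (ler_cvg_to (cvgB (ua (a - z)) (cvg_cst (inner z (a - z))))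
                   (cvg_cst (r * `|a - z|))).
apply: nearW => n.
suff : inner (u n - z) (a - z) <= r * `|a - z| by rewrite innerBl.
by apply: le_trans (cauchy_schwarz_le _ _) _; rewrite ler_wpM2r.
Qed.

Lemma fejer_cvg (R : realType) (X : hilbertType R) (u : nat -> X) (z : X) :
  (forall n, `|u n.+1 - z| <= `|u n - z|) ->
  cvgn (fun n => `|u n - z| ^+ 2).
Proof.
move=> uz; apply: (cvgP (inf (range (fun n => `|u n - z| ^+ 2)))).
apply: nonincreasing_cvgn.
  apply/nonincreasing_seqP => n.
  by rewrite ler_sqr// nnegrE.
by exists 0 => _ [n _ <-]; exact: sqr_ge0.
Qed.

(** Opial's argument.  Distances to points of [S] decrease, hence converge; for two
    weak cluster points [a], [b] in [S] the polarization
    [2 (u n | a - b) = |u n - b|^2 - |u n - a|^2 + |a|^2 - |b|^2] then shows that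
    [(u n | a - b)] converges, so [(a | a - b) = (b | a - b)] and [a = b]. *)
Lemma opial (R : realType) (X : hilbertType R) (u : nat -> X) (S : set X)
    (M : R) :
  (forall n, `|u n| <= M) ->
  (forall z, S z -> forall n, `|u n.+1 - z| <= `|u n - z|) ->
  (forall (U : set_system nat) a, UltraFilter U -> \oo `<=` U ->
    (forall v, inner (u n) v @[n --> U] --> inner a v) -> S a) ->
  exists2 a, S a & forall v, inner (u n) v @[n --> \oo] --> inner a v.
Proof.
move=> uM fej clS.
have [U [UU ooU]] := @ultraFilterLemma _ \oo _.
have [a aP] := weak_compactness UU uM.
have Sa := clS _ _ UU ooU aP.
exists a => // v; apply: cvg_ultra => V VV ooV.
have [b bP] := weak_compactness VV uM.
have Sb := clS _ _ VV ooV bP.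
suff -> : a = b by exact: bP.
have /cvg_ex[l lP] : cvgn (fun n => inner (u n) (a - b)).
  have -> : (fun n => inner (u n) (a - b)) =
      (fun n => 2^-1 * (`|u n - b| ^+ 2 - `|u n - a| ^+ 2
                        + (`|a| ^+ 2 - `|b| ^+ 2))).
    by apply/funext => n; rewrite !sqnormB linearBr; field.
  apply: is_cvgM; first exact: is_cvg_cst.
  apply: is_cvgD; last exact: is_cvg_cst.
  by apply: is_cvgB; apply: fejer_cvg; exact: fej.
have la : inner a (a - b) = l.
  apply: (@cvg_unique _ (@Rhausdorff R) _ _ _ _ (aP (a - b))).
  by move=> B /lP; exact: ooU.
have lb : inner b (a - b) = l.
  apply: (@cvg_unique _ (@Rhausdorff R) _ _ _ _ (bP (a - b))).
  by move=> B /lP; exact: ooV.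
apply/eqP; rewrite -subr_eq0 -normr_eq0 -sqrf_eq0 -inner_norm innerBl.
by rewrite la lb subrr.
Qed.

(** * Consequences of the tangential cone condition *)

(** With [A] the derivative at [x], [v = x - z] for a solution [z] and
    [r] the residual at [x], the hypothesis is the tangential cone condition.  The
    conclusion says that [z] lies in a half-space that [x] violates by
    [(1 - eta) |r|^2], whose normal is the search direction. *)
Lemma tangential_cone_descent (R : realType) (X Y : hilbertType R)
    (A : X -> Y) (r : Y) (v : X) (eta : R) :
  bounded_linear A -> `|r - A v| <= eta * `|r| ->
  (1 - eta) * `|r| ^+ 2 <= inner v (adjoint A r).
Proof.
move=> bA rA; rewrite -adjointE//.
have -> : inner (A v) r = `|r| ^+ 2 - inner (r - A v) r.
  by rewrite innerBl inner_norm; ring.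
have := cauchy_schwarz_le (r - A v) r.
have := ler_wpM2r (normr_ge0 r) rA.
lra.
Qed.

Lemma adjoint_le (R : realType) (X Y : hilbertType R) (A : X -> Y) (w : Y)
    (C : R) :
  0 <= C -> bounded_linear A -> (opnorm A <= C%:E)%E ->
  `|adjoint A w| <= C * `|w|.
Proof.
move=> C0 bA AC; set d := adjoint A w.
have [->|d0] := eqVneq d 0; first by rewrite normr0 mulr_ge0.
have nd : 0 < `|d| by rewrite normr_gt0.
rewrite -(ler_pM2r nd) -expr2 -inner_norm -adjointE//.
apply: le_trans (cauchy_schwarz_le _ _) _.
rewrite mulrAC; apply: ler_wpM2r => //.
by apply: opnorm_le => //; case: bA.
Qed.

(** A substitute for weak closedness of [G].  The cone condition is linearized at
    the weak limit [a], not at the points [u n]: the linear term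
    [A (u n - a)] then tends weakly to 0, and pairing the condition with
    [w = b - G a] gives [|w|^2 <= eta |w|^2] in the limit. *)
Lemma tangential_cone_weak_closed (R : realType) (X Y : hilbertType R)
    (U : set_system nat) {UU : ProperFilter U} (G : X -> Y) (A : X -> Y)
    (u : nat -> X) (a : X) (b : Y) (eta : R) :
  eta < 1 -> bounded_linear A ->
  (forall n, `|G (u n) - G a - A (u n - a)| <= eta * `|G (u n) - G a|) ->
  (forall v, inner (u n) v @[n --> U] --> inner a v) ->
  G (u n) @[n --> U] --> b ->
  G a = b.
Proof.
move=> eta1 bA tcc ua Gub.
set w := b - G a.
have lhs : inner (G (u n) - G a) w - inner (u n - a) (adjoint A w) @[n --> U]
    --> `|w| ^+ 2 - 0.
  apply: cvgB.
    rewrite -inner_norm; apply/subr_cvg0.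
    apply: (@norm_le_cvg0 _ _ _ _ _ _ (fun n => G (u n) - b) _ `|w|).
      apply: nearW => n; rewrite -innerBl /=.
      rewrite (_ : _ - w = G (u n) - b); last by rewrite /w opprB addrA subrK.
      by rewrite mulrC; exact: cauchy_schwarz.
    exact/subr_cvg0.
  rewrite -(subrr (inner a (adjoint A w))).
  under eq_fun do rewrite innerBl.
  by apply: cvgB => //; exact: cvg_cst.
have rhs : eta * `|G (u n) - G a| * `|w| @[n --> U] --> eta * `|w| * `|w|.
  apply: cvgM; last exact: cvg_cst.
  apply: cvgM; first exact: cvg_cst.
  by apply: cvg_norm; apply: cvgB => //; exact: cvg_cst.
have : `|w| ^+ 2 - 0 <= eta * `|w| * `|w|.
  apply: (ler_cvg_to lhs rhs); apply: nearW => n.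
  rewrite -adjointE// -innerBl.
  by apply: le_trans (cauchy_schwarz_le _ _) _; rewrite ler_wpM2r.
rewrite subr0 -mulrA -expr2 => h.
have : `|w| ^+ 2 <= 0.
  rewrite -(pmulr_rle0 _ (_ : 0 < 1 - eta)) ?subr_gt0//; lra.
rewrite le_eqVlt ltNge sqr_ge0 orbF sqrf_eq0 normr_eq0 subr_eq0.
by move=> /eqP.
Qed.

(** * The PLWK step *)

(** The product [lambda * (1 - eta) * |r|^2], which for a nonzero search direction
    is the squared distance from [x] to the half-space of the step; it measures the progress towards every
    solution. *)
Definition plwk_gain (R : realType) (X Y : hilbertType R) (N : nat)
    (F : 'I_N -> X -> Y) (y : 'I_N -> Y) (eta : R) (i : 'I_N) (x : X) : R :=
  plwk_lambda F y eta i x * ((1 - eta) * `|F i x - y i| ^+ 2).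

Lemma plwk_lambda_ge0 (R : realType) (X Y : hilbertType R) (N : nat)
    (F : 'I_N -> X -> Y) (y : 'I_N -> Y) (eta : R) (i : 'I_N) (x : X) :
  eta < 1 -> 0 <= plwk_lambda F y eta i x.
Proof.
move=> eta1; rewrite /plwk_lambda; case: ifP => // _.
by rewrite divr_ge0// ?mulr_ge0 ?sqr_ge0// subr_ge0 ltW.
Qed.

Lemma plwk_gain_ge0 (R : realType) (X Y : hilbertType R) (N : nat)
    (F : 'I_N -> X -> Y) (y : 'I_N -> Y) (eta : R) (i : 'I_N) (x : X) :
  eta < 1 -> 0 <= plwk_gain F y eta i x.
Proof.
move=> eta1; rewrite /plwk_gain mulr_ge0 ?plwk_lambda_ge0//.
by rewrite mulr_ge0 ?sqr_ge0// subr_ge0 ltW.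
Qed.

(** The step is a relaxed projection onto the half-space of
    [tangential_cone_descent].  Expanding the square gives the decrease of the
    distance to [z] and the length of the step; the gain controls the residual
    because [|d| <= C |r|] for the direction [d]. *)
Lemma plwk_step (R : realType) (X Y : hilbertType R) (N : nat)
    (F : 'I_N -> X -> Y) (y : 'I_N -> Y) (i : 'I_N) (x z : X)
    (C eta theta : R) :
  0 < C -> eta < 1 -> 0 < theta ->
  bounded_linear (gateaux (F i) x) -> (opnorm (gateaux (F i) x) <= C%:E)%E ->
  F i z = y i ->
  `|F i z - F i x - gateaux (F i) x (z - x)| <= eta * `|F i z - F i x| ->
  let x' := x - (theta * plwk_lambda F y eta i x * plwk_omega F y i x)
                     *: plwk_dir F y i x in
  let g := plwk_gain F y eta i x in
  [/\ `|x' - z| ^+ 2 + theta * (2 - theta) * g <= `|x - z| ^+ 2,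
      `|x' - x| ^+ 2 = theta ^+ 2 * g &
      (1 - eta) ^+ 2 * `|F i x - y i| ^+ 2 <= C ^+ 2 * g].
Proof.
move=> C0 eta1 th0 bA AC zy.
rewrite zy => tcc x' g.
have eta1' : 0 < 1 - eta by rewrite subr_gt0.
have dge : (1 - eta) * `|F i x - y i| ^+ 2 <= inner (x - z) (plwk_dir F y i x).
  apply: tangential_cone_descent => //.
  move: tcc; rewrite -normrN (distrC (y i)); congr (`|_| <= _).
  have [linA _] := bA.
  pose L := HB.pack_for {linear X -> Y} (gateaux (F i) x)
    (GRing.isLinear.Build _ _ _ _ _ linA).
  rewrite -[gateaux (F i) x]/(L : _ -> _) -(opprB x z) linearN opprK.
  by rewrite opprD opprB.
have dle : `|plwk_dir F y i x| ^+ 2 <= C ^+ 2 * `|F i x - y i| ^+ 2.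
  rewrite -exprMn ler_sqr ?nnegrE ?mulr_ge0//; last exact: ltW.
  by apply: adjoint_le => //; exact: ltW.
have L0 := plwk_lambda_ge0 F y i x eta1.
have Ld : plwk_lambda F y eta i x * `|plwk_dir F y i x| ^+ 2
    = (1 - eta) * `|F i x - y i| ^+ 2.
  (* A vanishing direction forces a vanishing residual by [dge], so both sides are
     zero in the exceptional case of the step size. *)
  rewrite /plwk_lambda; case: eqVneq => [d0|d0] /=; last first.
    by rewrite divfK// sqrf_eq0 normr_eq0.
  apply/eqP; rewrite eq_le mul0r mulr_ge0 ?sqr_ge0 ?(ltW eta1')//=.
  by apply: le_trans dge _; rewrite d0 linear0r.
have Lom : plwk_lambda F y eta i x * plwk_omega F y i x
    = plwk_lambda F y eta i x.
  rewrite /plwk_omega; case: eqVneq => [Fxy|_] /=; last by rewrite mulr1.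
  rewrite mulr0 /plwk_lambda Fxy subrr normr0 expr0n /= mulr0 mul0r.
  by case: ifP.
rewrite /x' -mulrA Lom /g /plwk_gain.
move: (plwk_lambda _ _ _ _ _) L0 Ld => L L0 Ld.
move: (plwk_dir _ _ _ _) (`|F i x - y i| ^+ 2) dge dle Ld => d r2 dge dle Ld.
split.
- have -> : x - (theta * L) *: d - z = x - z - (theta * L) *: d.
    by rewrite addrAC.
  rewrite sqnormB innerZr sqnormZ.
  have -> : (theta * L) ^+ 2 * `|d| ^+ 2 = theta ^+ 2 * L * (L * `|d| ^+ 2).
    by ring.
  rewrite Ld -subr_ge0.
  have := ler_wpM2l (mulr_ge0 (ltW th0) L0) dge; lra.
- by rewrite addrAC subrr sub0r normrN sqnormZ -Ld; ring.
- rewrite expr2 -mulrA [leRHS](_ : _ = (1 - eta) * (L * (C ^+ 2 * r2))); last by ring.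
  rewrite ler_pM2l// -Ld.
  by apply: ler_wpM2l.
Qed.

Lemma plwk_sequence_step (R : realType) (X Y : hilbertType R)
    (N : nat) (N_gt0 : (0 < N)%N)
    (D : 'I_N -> set X) (F : 'I_N -> X -> Y) (y : 'I_N -> Y)
    (x0 : X) (C rho eta : R) (theta : nat -> R) (x : nat -> X) (z : X)
    (k : nat) :
  assumption_A1 D F x0 C rho -> assumption_A2 F x0 rho eta ->
  (forall k, 0 < theta k < 2) ->
  plwk_sequence F y N_gt0 eta theta x0 x ->
  ball x0 rho z -> (forall i, F i z = y i) -> ball x0 rho (x k) ->
  let i := cyc N_gt0 k in let g := plwk_gain F y eta i (x k) in
  [/\ `|x k.+1 - z| ^+ 2 + theta k * (2 - theta k) * g <= `|x k - z| ^+ 2,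
      `|x k.+1 - x k| ^+ 2 = theta k ^+ 2 * g &
      (1 - eta) ^+ 2 * `|F i (x k) - y i| ^+ 2 <= C ^+ 2 * g].
Proof.
move=> [_ _ _ [C0 _] [_ gd opC]] [/andP[_ eta1] tcc] th [_ xS] zB Fz xB.
have [_ gbl] := gd (cyc N_gt0 k) _ xB; have /andP[t0 _] := th k.
rewrite [x k.+1]xS.
exact: plwk_step C0 eta1 t0 gbl (opC _ _ xB) (Fz _) (tcc _ _ _ xB zB).
Qed.

Lemma plwk_fejer (R : realType) (X Y : hilbertType R)
    (N : nat) (N_gt0 : (0 < N)%N)
    (D : 'I_N -> set X) (F : 'I_N -> X -> Y) (y : 'I_N -> Y)
    (x0 : X) (C rho eta : R) (theta : nat -> R) (x : nat -> X) (z : X)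
    (k : nat) :
  assumption_A1 D F x0 C rho -> assumption_A2 F x0 rho eta ->
  (forall k, 0 < theta k < 2) ->
  plwk_sequence F y N_gt0 eta theta x0 x ->
  ball x0 rho z -> (forall i, F i z = y i) -> ball x0 rho (x k) ->
  `|x k.+1 - z| <= `|x k - z|.
Proof.
move=> A1 A2 th xP zB Fz xB; have [_ eta1] := andP A2.1.
have [h _ _] := plwk_sequence_step A1 A2 th xP zB Fz xB.
rewrite -ler_sqr ?nnegrE//; apply: le_trans h.
have /andP[t0 t2] := th k.
by rewrite lerDl mulr_ge0 ?plwk_gain_ge0// mulr_ge0 ?subr_ge0 ?ltW.
Qed.

Lemma closer_in_ball (R : realType) (V : normedModType R) (x0 xs w : V)
    (rho : R) :
  ball x0 (rho / 2) xs -> `|w - xs| <= `|x0 - xs| -> ball x0 rho w.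
Proof.
rewrite -!ball_normE /= => xsb h; rewrite -(subrKA xs).
apply: le_lt_trans (ler_normD _ _) _; rewrite (distrC xs).
by apply: le_lt_trans (lerD (lexx _) h) _; rewrite [ltRHS]splitr ltrD.
Qed.

(** The estimates are available only inside the ball, so membership and the bound
    on the distance to [xs] must be propagated together; [xs] lies within
    [rho / 2] of the centre, which leaves room for points as close to [xs] as the
    initial one. *)
Lemma plwk_in_ball (R : realType) (X Y : hilbertType R)
    (N : nat) (N_gt0 : (0 < N)%N)
    (D : 'I_N -> set X) (F : 'I_N -> X -> Y) (y : 'I_N -> Y)
    (x0 : X) (C rho eta : R) (theta : nat -> R) (x : nat -> X) (xs : X) :
  assumption_A1 D F x0 C rho -> assumption_A2 F x0 rho eta ->
  (forall k, 0 < theta k < 2) ->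
  plwk_sequence F y N_gt0 eta theta x0 x ->
  ball x0 (rho / 2) xs -> (forall i, F i xs = y i) ->
  forall k, ball x0 rho (x k) /\ `|x k - xs| <= `|x0 - xs|.
Proof.
move=> A1 A2 th xP xsb Fxs.
have xsB : ball x0 rho xs by apply: closer_in_ball xsb _; rewrite subrr normr0.
elim=> [|k [xB xk]].
  by rewrite xP.1; split=> //; exact: closer_in_ball xsb _.
suff h : `|x k.+1 - xs| <= `|x0 - xs|.
  by split=> //; exact: closer_in_ball xsb h.
exact: le_trans (plwk_fejer A1 A2 th xP xsB Fxs xB) xk.
Qed.

(** * Asymptotics along the cyclic order *)

Lemma decrement_cvg0 (R : realType) (a : nat -> R) :
  cvgn a -> a n - a n.+1 @[n --> \oo] --> 0.
Proof.
move=> /cvg_ex[l al]; rewrite -(subrr l); apply: cvgB => //.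
by rewrite cvg_shiftS.
Qed.

Lemma le_scaled_cvg0 (R : realType) (T : Type) (U : set_system T)
    {FU : Filter U} (c : R) (a b : T -> R) :
  0 < c -> (forall t, 0 <= b t) -> (forall t, c * b t <= a t) ->
  a t @[t --> U] --> 0 -> b t @[t --> U] --> 0.
Proof.
move=> c0 b0 ba; apply: (@norm_le_cvg0 _ _ _ _ _ _ _ _ c^-1).
apply: nearW => t; rewrite ger0_norm// mulrC ler_pdivlMr// mulrC.
exact: le_trans (ba t) (ler_norm _).
Qed.

Lemma asymptotically_regular_shift (R : realType) (V : normedModType R)
    (u : nat -> V) (s : nat -> nat) (K : nat) :
  u n.+1 - u n @[n --> \oo] --> 0 ->
  (forall n, (n <= s n <= n + K)%N) ->
  u (s n) - u n @[n --> \oo] --> 0.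
Proof.
move=> u0 sK; apply/cvgr0Pnorm_le => e e0.
have eK : 0 < e / K.+1%:R by rewrite divr_gt0.
have [n0 _ n0P] := cvgr0_norm_le _ u0 _ eK.
exists n0 => // n /= n0n.
have step j : `|u (n + j)%N - u n| <= j%:R * (e / K.+1%:R).
  elim: j => [|j IHj]; first by rewrite addn0 subrr normr0 mul0r.
  have := n0P (n + j)%N (leq_trans n0n (leq_addr _ _)).
  rewrite /= addnS -[j.+1%:R]natr1 mulrDl mul1r => h.
  apply: le_trans (lerD IHj h).
  rewrite -(subrKA (u (n + j)%N)) [X in `|X| <= _]addrC.
  exact: ler_normD.
have /andP[ns sn] := sK n.
rewrite -(subnKC ns); apply: le_trans (step _) _.
rewrite mulrCA ger_pMr// ler_pdivrMr// mul1r ler_nat.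
by rewrite leq_subLR (leq_trans sn)// leq_add2l.
Qed.

(** From any time [k], equation [i] is used again within two sweeps; the witness
    sits in the sweep after the one containing [k]. *)
Lemma cyc_shift (N : nat) (N_gt0 : (0 < N)%N) (i : 'I_N) (k : nat) :
  exists k', (k <= k' <= k + N.*2)%N /\ cyc N_gt0 k' = i.
Proof.
exists ((k %/ N).+1 * N + i)%N; split; last first.
  by apply: val_inj; rewrite /= modnMDl modn_small.
have ik := ltn_ord i; rewrite mulSn -addnn.
have := divn_eq k N; have := ltn_pmod k N_gt0.
lia.
Qed.

Unset Implicit Arguments.
Set Strict Implicit.

Theorem theorem4p1 (R : realType) (X Y : hilbertType R)
    (N : nat) (N_gt0 : (0 < N)%N)
    (D : 'I_N -> set X) (F : 'I_N -> X -> Y) (y : 'I_N -> Y)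
    (x0 : X) (C rho eta : R) (theta : nat -> R) (x : nat -> X) :
  assumption_A1 D F x0 C rho ->
  assumption_A2 F x0 rho eta ->
  assumption_A3 F y x0 rho ->
  (forall k, 0 < theta k < 2) ->
  plwk_sequence F y N_gt0 eta theta x0 x ->
  0 < inf (range theta) ->
  sup (range theta) < 2 ->
  exists xbar : X,
    [/\ weakly_cvg x xbar, ball x0 rho xbar & forall i, F i xbar = y i].
Proof.
move=> A1 A2 [xs [xsb Fxs]] th xP inf0 sup2.
have [_ eta1] := andP A2.1; have [_ _ _ [C0 rho0] [_ gd _]] := A1.
have xsB : ball x0 rho xs by apply: closer_in_ball xsb _; rewrite subrr normr0.
have xin := plwk_in_ball A1 A2 th xP xsb Fxs.
have thinf k : inf (range theta) <= theta k.
  apply: ge_inf; last by exists k.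
  by exists 0 => _ [j _ <-]; have /andP[/ltW] := th j.
have thsup k : theta k <= sup (range theta).
  apply: ub_le_sup; last by exists k.
  by exists 2 => _ [j _ <-]; have /andP[_ /ltW] := th j.
pose g k := plwk_gain F y eta (cyc N_gt0 k) (x k).
have g_ge0 k : 0 <= g k by exact: plwk_gain_ge0.
have step k := plwk_sequence_step A1 A2 th xP xsB Fxs (xin k).1.
(* The gains are dominated by the decrements of a convergent sequence, since
   [theta k * (2 - theta k)] stays away from 0. *)
have g0 : g k @[k --> \oo] --> 0.
  apply: (@le_scaled_cvg0 _ _ _ _ (inf (range theta) * (2 - sup (range theta)))
            (fun k => `|x k - xs| ^+ 2 - `|x k.+1 - xs| ^+ 2)) => //.
  - by rewrite mulr_gt0// subr_gt0.
  - move=> k; have [h _ _] := step k; rewrite lerBrDl; apply: le_trans h.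
    rewrite lerD2l ler_wpM2r// ler_pM// ?subr_ge0 ?(ltW inf0) ?(ltW sup2)//.
    by rewrite lerD2l lerN2.
  - have /fejer_cvg/decrement_cvg0 : forall k, `|x k.+1 - xs| <= `|x k - xs|.
      by move=> k; exact: plwk_fejer A1 A2 th xP xsB Fxs (xin k).1.
    exact.
have step0 : x k.+1 - x k @[k --> \oo] --> 0.
  apply: (@sqnorm_le_cvg0 _ _ _ _ _ _ (fun k => 4 * g k)).
    apply: nearW => k; have [_ -> _] := step k.
    have -> : 4 = 2 ^+ 2 :> R by rewrite -natrX.
    have /andP[t0 t2] := th k.
    by rewrite ler_wpM2r ?plwk_gain_ge0// ler_sqr ?nnegrE ?ltW.
  rewrite -[X in _ --> X](mulr0 (4 : R)).
  by apply: cvgM => //; exact: cvg_cst.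
have res0 : `|F (cyc N_gt0 k) (x k) - y (cyc N_gt0 k)| ^+ 2 @[k --> \oo] --> 0.
  apply: (@le_scaled_cvg0 _ _ _ _ ((1 - eta) ^+ 2) (fun k => C ^+ 2 * g k)).
  - by rewrite exprn_gt0// subr_gt0.
  - by move=> k; exact: sqr_ge0.
  - by move=> k; have [] := step k.
  - rewrite -[X in _ --> X](mulr0 (C ^+ 2)).
    by apply: cvgM => //; exact: cvg_cst.
pose S := [set z | ball x0 rho z /\ forall i, F i z = y i].
have [||U a UU ooU xa|xbar [xbB Fxb] xw] := @opial _ _ x S (`|x0 - xs| + `|xs|).
- move=> k; rewrite -[x k](subrK xs); apply: le_trans (ler_normD _ _) _.
  by rewrite lerD2r (xin k).2.
- by move=> z [zB Fz] k; exact: plwk_fejer A1 A2 th xP zB Fz (xin k).1.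
- have aB : ball x0 rho a.
    apply: closer_in_ball xsb _.
    by apply: (weak_cvg_ball xa) => k; exact: (xin k).2.
  split=> // i.
  (* Shifting [x] to the times at which equation [i] is treated changes it by a
     null sequence, so the weak limit is unchanged while the residuals of
     equation [i] vanish. *)
  have [s /all_and2[sk si]] := choice (cyc_shift N_gt0 i).
  have s0 := asymptotically_regular_shift step0 sk.
  have [_ Abl] := gd i _ aB.
  apply: (@tangential_cone_weak_closed _ _ _ U _ (F i) (gateaux (F i) a) (x \o s) a
            (y i) eta) => //.
  + by move=> k; exact: A2.2 aB (xin _).1.
  + move=> v; rewrite -[X in _ --> X]add0r.
    have -> : (fun k => inner ((x \o s) k) v) =
        (fun k => inner (x (s k) - x k) v + inner (x k) v).
      by apply/funext => k; rewrite innerBl subrK.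
    apply: cvgD; last exact: xa.
    apply: (@norm_le_cvg0 _ _ _ _ _ _ (fun k => x (s k) - x k) _ `|v|).
      by apply: nearW => k; rewrite mulrC; exact: cauchy_schwarz.
    by move=> B /s0; exact: ooU.
  + apply/subr_cvg0.
    have sU : s k @[k --> U] --> \oo.
      move=> B [m _ mB]; apply: ooU; exists m => // k /= mk.
      by apply: mB => /=; apply: leq_trans mk _; case/andP: (sk k).
    apply: (@sqnorm_le_cvg0 _ _ _ _ _ _ (fun k => `|F i (x (s k)) - y i| ^+ 2)).
      exact: nearW.
    under eq_fun => k do rewrite -[i in F i](si k) -[i in y i](si k).
    exact: (cvg_comp _ _ sU res0).
- exists xbar; split=> // f /riesz[z fz].
  rewrite fz; under eq_fun do rewrite fz.
  exact: xw.
Qed.
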